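(* For every positive integer $n$, the hyperbolic space $(H^n(\mathbb{R}),d_h)$ is absolutely homogeneous.
   Context: The hyperbolic space is $H^n(\mathbb{R})=\mathbb{R}^n$ with the metric $d_h(x,y)=\cosh^{-1}([x][y]-\langle x,y\rangle)$, where $\langle\cdot,\cdot\rangle$ is the standard inner product, $[x]=\sqrt{1+\|x\|^2}$ with $\|\cdot\|$ the Euclidean norm, and $\cosh^{-1}(t)=\log(t+\sqrt{t^2-1})$ for $t\ge1$. A map between metric spaces is isometric if it preserves distances; an isometry is a surjective isometric map. A metric space $(X,d)$ is absolutely homogeneous if every isometric map $f_0\colon(X_0,d)\to(X,d)$ defined on a non-empty subset $X_0\subset X$ extends to an isometry $f\colon(X,d)\to(X,d)$. *)

(* Defs.v *)
From HB Require Import structures.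
From mathcomp Require Import all_boot all_order all_algebra.
From mathcomp Require Import ring lra.
From mathcomp Require Import all_classical all_reals all_analysis.

Set Implicit Arguments.
Unset Strict Implicit.
Unset Printing Implicit Defensive.

Import Order.TTheory GRing.Theory Num.Theory.

Local Open Scope classical_set_scope.
Local Open Scope ring_scope.

Section metric_maps.
Context {R : numDomainType}.

(* Partial maps are total functions whose values matter only on [D]; the
   metric on [D] is the restriction of the ambient one. *)
Definition isometric_on (X Y : metricType R) (D : set X) (f : X -> Y) : Prop :=
  forall x y, D x -> D y -> mdist (f x) (f y) = mdist x y.

Definition isometry (X Y : metricType R) (f : X -> Y) : Prop :=
  isometric_on [set: X] f /\ set_surj [set: X] [set: Y] f.

Definition absolutely_homogeneous (X : metricType R) : Prop :=
  forall (X0 : set X) (f0 : X -> X), X0 !=set0 -> isometric_on X0 f0 ->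
    exists f : X -> X, isometry f /\ forall x, X0 x -> f x = f0 x.

End metric_maps.

Section hyperbolic_distance.
Context {R : realType}.

Definition arcosh (t : R) : R := ln (t + Num.sqrt (t ^+ 2 - 1)).

Context {n : nat}.
Implicit Types x y : 'rV[R]_n.

Definition dotp x y : R := \sum_(i < n) x ord0 i * y ord0 i.

(* The library's norm on row vectors is the sup norm. *)
Definition enorm x : R := Num.sqrt (dotp x x).

Definition hbracket x : R := Num.sqrt (1 + enorm x ^+ 2).

Definition hdist x y : R := arcosh (hbracket x * hbracket y - dotp x y).

End hyperbolic_distance.

Section hdist_metric.
Context {R : realType} {n : nat}.
Implicit Types x y z : 'rV[R]_n.

Lemma dotpC x y : dotp x y = dotp y x.
Proof. by apply: eq_bigr => i _; rewrite mulrC. Qed.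

Lemma dotpDl x y z : dotp (x + y) z = dotp x z + dotp y z.
Proof. by rewrite -big_split; apply: eq_bigr => i _; rewrite mxE mulrDl. Qed.

Lemma dotpZl (a : R) x y : dotp (a *: x) y = a * dotp x y.
Proof. by rewrite mulr_sumr; apply: eq_bigr => i _; rewrite mxE mulrA. Qed.

Lemma dotpDr x y z : dotp x (y + z) = dotp x y + dotp x z.
Proof. by rewrite dotpC dotpDl !(dotpC x). Qed.

Lemma dotpZr (a : R) x y : dotp x (a *: y) = a * dotp x y.
Proof. by rewrite dotpC dotpZl dotpC. Qed.

Definition dotpE := (dotpDl, dotpZl, dotpDr, dotpZr).

Lemma dotp_ge0 x : 0 <= dotp x x.
Proof. by apply: sumr_ge0 => i _; rewrite -expr2 sqr_ge0. Qed.

Lemma dotp_eq0 x : dotp x x = 0 -> x = 0.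
Proof.
move=> /eqP; rewrite psumr_eq0 => [|i _]; last by rewrite -expr2 sqr_ge0.
move=> /allP x0; apply/rowP => i; rewrite mxE.
by have /= := x0 i (mem_index_enum _); rewrite mulf_eq0 orbb => /eqP.
Qed.

Lemma dotp_CS x y : dotp x y ^+ 2 <= dotp x x * dotp y y.
Proof.
have [y0|y0] := eqVneq (dotp y y) 0.
  have -> : y = 0 *: y by rewrite scale0r; exact: dotp_eq0.
  by rewrite !dotpE !mul0r mulr0 expr0n.
have y_gt0 : 0 < dotp y y by rewrite lt_neqAle eq_sym y0 dotp_ge0.
rewrite -subr_ge0 -(pmulr_rge0 _ y_gt0).
have := dotp_ge0 (dotp y y *: x + (- dotp x y) *: y).
rewrite !dotpE (dotpC y x).
by congr (0 <= _); ring.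
Qed.

Lemma hbracket2 x : hbracket x ^+ 2 = 1 + dotp x x.
Proof.
rewrite /hbracket sqr_sqrtr; last by rewrite addr_ge0 ?ler01 ?sqr_ge0.
by rewrite /enorm sqr_sqrtr ?dotp_ge0.
Qed.

Lemma hbracket_gt0 x : 0 < hbracket x.
Proof. by rewrite sqrtr_gt0 ltr_wpDr ?sqr_ge0. Qed.

Local Notation hcosh x y := (hbracket x * hbracket y - dotp x y).

Lemma hcosh_ge1 x y : 1 <= hcosh x y.
Proof.
rewrite lerBrDr; have h0 : 0 <= hbracket x * hbracket y.
  by rewrite mulr_ge0// ltW// hbracket_gt0.
case: (lerP (1 + dotp x y) 0) => [/le_trans|/ltW c0]; first exact.
rewrite -(@ler_pXn2r _ 2)// exprMn !hbracket2 -subr_ge0.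
have := dotp_ge0 (x + (-1) *: y); have := dotp_CS x y.
rewrite !dotpE (dotpC y x); lra.
Qed.

Lemma arcosh_ge1 (t : R) : 1 <= t -> 1 <= t + Num.sqrt (t ^+ 2 - 1).
Proof. by move=> t1; rewrite ler_wpDr ?sqrtr_ge0. Qed.

(* [(u, u0)] with [dotp u y = u0 * hbracket y] is Lorentz orthogonal to the
   point [(y, hbracket y)] of the hyperboloid. *)
Lemma lorentz_ge y u (u0 : R) : dotp u y = u0 * hbracket y ->
  dotp u u <= (dotp u u - u0 ^+ 2) * hbracket y ^+ 2.
Proof.
move=> uy; have := dotp_CS u y; rewrite uy exprMn mulrBl hbracket2; lra.
Qed.

Lemma lorentz_ge0 y u (u0 : R) : dotp u y = u0 * hbracket y ->
  0 <= dotp u u - u0 ^+ 2.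
Proof.
move=> uy; rewrite -(@pmulr_lge0 _ (hbracket y ^+ 2)) ?exprn_gt0 ?hbracket_gt0//.
exact: le_trans (dotp_ge0 u) (lorentz_ge uy).
Qed.

Lemma lorentz_CS y u v (u0 v0 : R) :
  dotp u y = u0 * hbracket y -> dotp v y = v0 * hbracket y ->
  (dotp u v - u0 * v0) ^+ 2 <= (dotp u u - u0 ^+ 2) * (dotp v v - v0 ^+ 2).
Proof.
move=> uy vy.
have hy : hbracket y != 0 by rewrite gt_eqF ?hbracket_gt0.
have [g0|g0] := eqVneq (dotp v v - v0 ^+ 2) 0.
  have v_0 : v = 0.
    apply: dotp_eq0; apply/eqP; rewrite eq_le dotp_ge0 andbT.
    by rewrite (le_trans (lorentz_ge vy))// g0 mul0r.
  have v00 : v0 = 0.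
    apply/eqP; have /eqP := vy; rewrite v_0 -(scale0r y) dotpZl mul0r.
    by rewrite eq_sym mulf_eq0 (negbTE hy) orbF.
  by rewrite v_0 v00 -(scale0r y) !dotpE !(mul0r, mulr0) subrr !expr0n subrr mulr0.
have g_gt0 : 0 < dotp v v - v0 ^+ 2 by rewrite lt_neqAle eq_sym g0 (lorentz_ge0 vy).
rewrite -subr_ge0 -(pmulr_rge0 _ g_gt0).
pose a := dotp v v - v0 ^+ 2; pose b := - (dotp u v - u0 * v0).
have /lorentz_ge0 : dotp (a *: u + b *: v) y = (a * u0 + b * v0) * hbracket y.
  by rewrite !dotpE uy vy; ring.
by rewrite !dotpE (dotpC v u) /a /b; congr (0 <= _); ring.
Qed.

Lemma lorentz_proj x y :
  dotp (x + (- hcosh x y) *: y) y =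
  (hbracket x - hcosh x y * hbracket y) * hbracket y.
Proof.
rewrite !dotpE.
have -> : dotp y y = hbracket y ^+ 2 - 1 by rewrite hbracket2; ring.
ring.
Qed.

Lemma lorentz_proj_sqr x y (u := x + (- hcosh x y) *: y) :
  dotp u u - (hbracket x - hcosh x y * hbracket y) ^+ 2 = hcosh x y ^+ 2 - 1.
Proof.
rewrite /u !dotpE (dotpC y x).
have -> : dotp x x = hbracket x ^+ 2 - 1 by rewrite hbracket2; ring.
have -> : dotp y y = hbracket y ^+ 2 - 1 by rewrite hbracket2; ring.
ring.
Qed.

Lemma hcosh_triangle x y z :
  hcosh x z <= hcosh x y * hcosh y z +
    Num.sqrt (hcosh x y ^+ 2 - 1) * Num.sqrt (hcosh y z ^+ 2 - 1).
Proof.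
have yz : hcosh y z = hcosh z y by rewrite dotpC mulrC.
rewrite yz -sqrtrM -?lorentz_proj_sqr ?(lorentz_ge0 (lorentz_proj x y))//.
rewrite -lerBlDl; apply: le_trans (ler_norm _) _.
rewrite -sqrtr_sqr; apply: ler_wsqrtr.
apply: le_trans (lorentz_CS (lorentz_proj x y) (lorentz_proj z y)).
rewrite !dotpE (dotpC y z).
have -> : dotp y y = hbracket y ^+ 2 - 1 by rewrite hbracket2; ring.
by rewrite -subr_ge0 le_eqVlt; apply/orP; left; apply/eqP; ring.
Qed.

Lemma hdistxx x : hdist x x = 0.
Proof.
rewrite /hdist /arcosh -expr2 hbracket2 addrK expr1n subrr sqrtr0 addr0.
exact: ln1.
Qed.

Lemma hdistC x y : hdist x y = hdist y x.
Proof. by rewrite /hdist mulrC dotpC. Qed.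

Lemma hdist_eq0 x y : hdist x y = 0 -> x = y.
Proof.
move=> d0; have t1 := hcosh_ge1 x y; have w1 := arcosh_ge1 t1.
have /eqP := d0; rewrite ln_eq0 ?(lt_le_trans ltr01)// => /eqP w.
have c1 : hcosh x y = 1.
  apply/eqP; rewrite eq_le t1 andbT -w lerDl; exact: sqrtr_ge0.
have := lorentz_ge (lorentz_proj x y).
rewrite lorentz_proj_sqr c1 expr1n subrr mul0r => u0.
have /dotp_eq0/eqP : dotp (x + -1 *: y) (x + -1 *: y) = 0.
  by apply/eqP; rewrite eq_le u0 dotp_ge0.
by rewrite scaleN1r subr_eq0 => /eqP.
Qed.

Lemma hdist_triangle y x z : hdist x z <= hdist x y + hdist y z.
Proof.
have := hcosh_triangle x y z; rewrite /hdist /arcosh.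
move: (hcosh_ge1 x y) (hcosh_ge1 y z) (hcosh_ge1 x z).
move: (hcosh x y) (hcosh y z) (hcosh x z) => s t p s1 t1 p1 pst.
have := arcosh_ge1 s1; have := arcosh_ge1 t1; have := arcosh_ge1 p1.
have := sqrtr_ge0 (s ^+ 2 - 1); have := sqrtr_ge0 (t ^+ 2 - 1).
have ge1 (r : R) : 1 <= r -> 0 <= r ^+ 2 - 1 by move=> r1; nra.
have := sqr_sqrtr (ge1 _ s1); have := sqr_sqrtr (ge1 _ t1).
move: pst.
set a := Num.sqrt (s ^+ 2 - 1); set b := Num.sqrt (t ^+ 2 - 1).
move=> pst b2 a2 b0 a0 p1' t1' s1'.
rewrite -lnM ?posrE ?(lt_le_trans ltr01)// ler_ln ?posrE;
  [|by lra|by rewrite mulr_gt0; lra].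
have r0 : 0 <= s * b + t * a by rewrite addr_ge0// mulr_ge0//; lra.
have -> : (s + a) * (t + b) = (s * t + a * b) + (s * b + t * a) by ring.
apply: lerD => //.
rewrite -(ger0_norm r0) -sqrtr_sqr; apply: ler_wsqrtr.
have -> : (s * b + t * a) ^+ 2 = (s * t + a * b) ^+ 2 - 1.
  transitivity ((s * t + a * b) ^+ 2 - (s ^+ 2 - a ^+ 2) * (t ^+ 2 - b ^+ 2)).
    by ring.
  by rewrite a2 b2; ring.
by rewrite lerB// ler_sqr ?nnegrE; lra.
Qed.

End hdist_metric.

(* An alias of row vectors carrying [hdist] instead of the sup-norm
   pseudometric that the library attaches to ['rV[R]_n]. *)
Definition hyperbolic (R : realType) (n : nat) : Type := 'rV[R]_n.

HB.instance Definition _ (R : realType) (n : nat) :=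
  Choice.copy (hyperbolic R n) 'rV[R]_n.

HB.instance Definition _ (R : realType) (n : nat) :=
  @isMetric.Build R (hyperbolic R n) (@hdist R n)
    hdistxx hdist_eq0 hdistC hdist_triangle.

Lemma mdist_hyperbolicE (R : realType) (n : nat) (x y : hyperbolic R n) :
  mdist x y = hdist x y.
Proof. by []. Qed.

(* Main.v *)
Require Import Defs.
From HB Require Import structures.
From mathcomp Require Import all_boot all_order all_algebra.
From mathcomp Require Import ring lra.
From mathcomp Require Import all_classical all_reals all_analysis.

(** In the hyperboloid model [x] is the point [(x, hbracket x)] and
    [cosh (hdist x y)] is minus the Lorentz product of [x] and [y].  For
    [a != b] the Lorentz reflection along the spacelike vector [a - b] swaps
    [a] and [b] and fixes every point equidistant from them, so composing such
    reflections realizes an isometric map on any finite set by an isometry.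
    Take finitely many points of [X0] whose lifts span the lifts of all of [X0]:
    a point of [X0] is determined by its distances to these points, hence an
    isometry that agrees with [f0] on them agrees with [f0] on [X0]. *)

Import Order.TTheory GRing.Theory Num.Theory.

Local Open Scope classical_set_scope.
Local Open Scope ring_scope.

(* [sesquilinear] exports another [isometry]. *)
Local Notation isometry := Defs.isometry.

(** * Extending isometric maps by composing reflections *)

Section metric_extension.
Context {R : numDomainType} {X : metricType R}.

Lemma isometry_id : isometry (@id X).
Proof. by split=> // y _; exists y. Qed.

Lemma isometry_comp {f g : X -> X} :
  isometry f -> isometry g -> isometry (f \o g).
Proof.
move=> [fi fs] [gi gs]; split=> [x y _ _|z _] /=; first by rewrite fi ?gi.
by have [y _ <-] := fs z I; have [x _ <-] := gs y I; exists x.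
Qed.

Definition has_reflections : Prop :=
  forall a b : X, exists s : X -> X,
    [/\ isometry s, s a = b & forall c, mdist a c = mdist b c -> s c = c].

Lemma extend_isometric_seq {A : set X} {f0 : X -> X} {s : seq X} :
  has_reflections -> isometric_on A f0 -> (forall x, x \in s -> A x) ->
  exists f : X -> X, isometry f /\ forall x, x \in s -> f x = f0 x.
Proof.
move=> refl f0i; elim: s => [_|p s IH sA].
  by exists id; split => //; exact: isometry_id.
have [|f [fI fs]] := IH; first by move=> x xs; apply: sA; rewrite inE xs orbT.
have [r [rI rp rfix]] := refl (f p) (f0 p).
exists (r \o f); split; first exact: isometry_comp.
move=> x; rewrite inE => /predU1P[-> //|xs] /=.
have Ap : A p by apply: sA; rewrite mem_head.
have Ax : A x by apply: sA; rewrite inE xs orbT.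
(* The values already matched survive: [f x = f0 x] is equidistant from [f p] and [f0 p], so [r]
   fixes it. *)
by rewrite fs//; apply: rfix; rewrite f0i// -fs// fI.1.
Qed.

Lemma absolutely_homogeneous_of_reflections :
  has_reflections ->
  (forall A : set X, exists s : seq X, (forall x, x \in s -> A x) /\
    forall x y, A x -> (forall p, p \in s -> mdist y p = mdist x p) -> y = x) ->
  absolutely_homogeneous X.
Proof.
move=> refl determ A f0 _ f0i; have [s [sA sdet]] := determ A.
have [f [fI fs]] := extend_isometric_seq refl f0i sA.
(* The preimage [y] of [f0 x] need not lie in [A], but it has the same distances to [s] as [x]. *)
exists f; split=> // x Ax; have [y _ fy] := fI.2 (f0 x) I.
rewrite -fy; congr f; apply/esym/sdet => // p ps.
by rewrite -fI.1// fy fs// f0i//; exact: sA.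
Qed.

End metric_extension.
Arguments has_reflections {R} X.

(** Choose [s] in [A] whose image spans a space of maximal dimension; adding a further point of [A]
    cannot enlarge the span. *)
Lemma finite_spanning_seq (K : fieldType) (vT : vectType K) (T : eqType)
    (f : T -> vT) (A : set T) :
  exists s : seq T, (forall x, x \in s -> A x) /\
    forall x, A x -> f x \in <<map f s>>%VS.
Proof.
pose P d := `[< exists s : seq T,
  (forall x, x \in s -> A x) /\ \dim <<map f s>> = d >].
have P0 : exists d, P d by exists (\dim <<map f [::]>>); apply/asboolP; exists [::].
have Pub d : P d -> (d <= \dim {:vT})%N.
  by move=> /asboolP[s [_ <-]]; exact/dimvS/subvf.
case: (ex_maxnP P0 Pub) => d /asboolP[s [sA sd]] dmax.
exists s; split=> // x Ax.
have sub : (<<map f s>> <= <<map f (x :: s)>>)%VS.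
  by rewrite /= span_cons addvSr.
have : <<map f s>>%VS == <<map f (x :: s)>>%VS.
  rewrite eqEdim sub sd; apply: dmax; apply/asboolP; exists (x :: s).
  by split=> // y; rewrite inE => /predU1P[->//|/sA].
by move=> /eqP ->; apply: memv_span; rewrite mem_head.
Qed.

(** * Hyperbolic distance in terms of the Lorentz product *)

Section hyperbolic_space.
Context {R : realType} {n : nat}.
Implicit Types x y a b : 'rV[R]_n.

Local Notation hcosh x y := (hbracket x * hbracket y - dotp x y).

Lemma hcoshxx x : hcosh x x = 1.
Proof. by rewrite -expr2 hbracket2 addrK. Qed.

Lemma hcoshC x y : hcosh x y = hcosh y x.
Proof. by rewrite mulrC dotpC. Qed.

(* [e^t + e^-t] recovers [2 cosh t]. *)
Lemma arcosh_inj : {in >= 1 &, injective (@arcosh R)}.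
Proof.
have inv (t : R) : 1 <= t ->
    t = (expR (arcosh t) + (expR (arcosh t))^-1) / 2.
  move=> t1; have w1 := arcosh_ge1 t1.
  rewrite /arcosh lnK ?posrE ?(lt_le_trans ltr01)//.
  have t2 : 0 <= t ^+ 2 - 1 by nra.
  have := sqr_sqrtr t2; move: w1; set r := Num.sqrt _ => w1 r2.
  have -> : (t + r)^-1 = t - r.
    apply: (mulfI (x := t + r)); first by rewrite gt_eqF// (lt_le_trans ltr01).
    rewrite divff ?gt_eqF ?(lt_le_trans ltr01)//.
    by rewrite mulrC -subr_sqr r2; ring.
  by field.
by move=> s t s1 t1 st; rewrite (inv s)// (inv t)// st.
Qed.

Lemma hdist_inj {x y} {x' y' : 'rV[R]_n} :
  hdist x y = hdist x' y' <-> hcosh x y = hcosh x' y'.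
Proof.
split=> [|e]; last by rewrite /hdist e.
by apply: arcosh_inj; exact: hcosh_ge1.
Qed.

Lemma hcosh_eq1 {x y} : hcosh x y = 1 -> x = y.
Proof. by move=> h; apply: hdist_eq0; rewrite -(hdistxx x) hdist_inj h hcoshxx. Qed.

(* A point of the two-sheeted hyperboloid whose Lorentz product with a point of
   the upper sheet is negative lies on the upper sheet. *)
Lemma hbracket_of_sheet {x} {x0 : R} b :
  x0 ^+ 2 = 1 + dotp x x -> 0 < x0 * hbracket b - dotp x b -> hbracket x = x0.
Proof.
rewrite -hbracket2 => /eqP; rewrite eqf_sqr => /orP[/eqP->//|/eqP->].
have := hcosh_ge1 (- x) b.
have -> : hbracket (- x) = hbracket x.
  by rewrite /hbracket /enorm -(scaleN1r x) !dotpE !mulN1r opprK.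
rewrite -(scaleN1r x) dotpE; lra.
Qed.

(** For [e] the difference of the lifts of [a] and [b], this is [- 2 <x, e> / <e, e>] in the Lorentz
    product, where [<e, e> = 2 * (hcosh a b - 1)]. *)
Definition hreflect_coef a b x : R :=
  (hcosh a x - hcosh b x) / (hcosh a b - 1).

Definition hreflect a b x : 'rV[R]_n := x + hreflect_coef a b x *: (a - b).

(** * Lorentz reflections *)

Section reflection.
Variables a b : 'rV[R]_n.
Hypothesis ab : a != b.

Lemma hcosh_neq1 : hcosh a b - 1 != 0.
Proof.
by rewrite subr_eq0; apply: contra_neq ab => /hcosh_eq1.
Qed.

Lemma hreflect_coefE x :
  hreflect_coef a b x * (hcosh a b - 1) = hcosh a x - hcosh b x.
Proof. by rewrite divfK// hcosh_neq1. Qed.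

(** The last coordinate of the reflected lift of [x]. *)
Let h x : R := hbracket x + hreflect_coef a b x * (hbracket a - hbracket b).

Lemma hreflect_form x y :
  h x * h y - dotp (hreflect a b x) (hreflect a b y) = hcosh x y.
Proof.
have := hreflect_coefE x; have := hreflect_coefE y.
rewrite /h /hreflect -(scaleN1r b) !dotpE (dotpC b a) (dotpC x a) (dotpC x b).
have -> : dotp a a = hbracket a ^+ 2 - 1 by rewrite hbracket2; ring.
have -> : dotp b b = hbracket b ^+ 2 - 1 by rewrite hbracket2; ring.
move: (hreflect_coef a b x) (hreflect_coef a b y) => k l.
move=> /eqP; rewrite -subr_eq0 => /eqP ly /eqP; rewrite -subr_eq0 => /eqP kx.
apply/eqP; rewrite -subr_eq0; apply/eqP.
(* Zero becomes a combination of the two coefficient relations, which turns the goal into a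
   polynomial identity. *)
have -> : (0 : R) = - (l * 0 + k * 0) by rewrite !mulr0 addr0 oppr0.
rewrite -{1}kx -ly.
move: (hbracket x) (hbracket y) (hbracket a) (hbracket b) => x0 y0 a0 b0.
move: (dotp x y) (dotp a b) (dotp a x) (dotp b x) (dotp a y) (dotp b y).
move=> xy' ab' ax bx ay bY.
ring.
Qed.

Lemma hreflect_coefl : hreflect_coef a b a = -1.
Proof.
rewrite /hreflect_coef hcoshxx (hcoshC b) -opprB mulNr divff//.
exact: hcosh_neq1.
Qed.

Lemma hreflect_coefr : hreflect_coef a b b = 1.
Proof. by rewrite /hreflect_coef hcoshxx divff// hcosh_neq1. Qed.

Lemma hreflectl : hreflect a b a = b.
Proof. by rewrite /hreflect hreflect_coefl scaleN1r opprB addrC subrK. Qed.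

Lemma hreflectr : hreflect a b b = a.
Proof. by rewrite /hreflect hreflect_coefr scale1r addrC subrK. Qed.

(** The reflection preserves the upper sheet: pairing the image of [x] with [b], the image of [a],
    gives [hcosh x a], which is positive. *)
Lemma hreflect_bracket x : hbracket (hreflect a b x) = h x.
Proof.
have ha : h a = hbracket b by rewrite /h hreflect_coefl; ring.
apply: (hbracket_of_sheet b).
  have := hreflect_form x x; rewrite hcoshxx => /eqP.
  by rewrite subr_eq -expr2 => /eqP.
have := hreflect_form x a; rewrite ha hreflectl => ->.
by rewrite (lt_le_trans ltr01)// hcosh_ge1.
Qed.

Lemma hreflect_hcosh x y :
  hcosh (hreflect a b x) (hreflect a b y) = hcosh x y.
Proof. by rewrite !hreflect_bracket hreflect_form. Qed.

Lemma hreflect_fix x : hcosh a x = hcosh b x -> hreflect a b x = x.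
Proof.
by move=> e; rewrite /hreflect /hreflect_coef e subrr mul0r scale0r addr0.
Qed.

Lemma hreflectK : involutive (hreflect a b).
Proof.
move=> x; rewrite {1}/hreflect.
(* The reflection swaps [a] and [b] and preserves [hcosh], so the numerator changes sign. *)
have -> : hreflect_coef a b (hreflect a b x) = - hreflect_coef a b x.
  have ra := hreflect_hcosh b x; rewrite hreflectr in ra.
  have rb := hreflect_hcosh a x; rewrite hreflectl in rb.
  by rewrite /hreflect_coef ra rb -mulNr [in RHS]opprB.
by rewrite scaleNr addrK.
Qed.

End reflection.

Lemma hyperbolic_has_reflections : has_reflections (hyperbolic R n).
Proof.
move=> a b; have [->|ab] := eqVneq a b.
  by exists id; split=> //; exact: isometry_id.
exists (hreflect a b); split; last 2 first.
- exact: hreflectl.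
- by move=> c /hdist_inj; exact: hreflect_fix.
split=> [x y _ _|y _]; first by apply/hdist_inj; exact: hreflect_hcosh.
by exists (hreflect a b y) => //; exact: hreflectK.
Qed.

Definition hlift x : 'rV[R]_n * R^o := (x, hbracket x).

Lemma hcosh_span {x y} {s : seq 'rV[R]_n} : hlift x \in <<map hlift s>>%VS ->
  (forall p, p \in s -> hcosh y p = hcosh x p) -> y = x.
Proof.
move=> xs yx; apply: hcosh_eq1; rewrite -[RHS](hcoshxx x).
(* Up to sign, the Lorentz product with the difference of the lifts of [y] and [x]. It vanishes on
   the lifts of [s], hence at [hlift x], where its value is [hcosh y x - 1]. *)
pose phi (w : 'rV[R]_n * R^o) : R^o :=
  (hbracket y - hbracket x) * w.2 - dotp (y - x) w.1.
have phi_lin : linear phi.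
  by move=> c u v; rewrite /phi /= !dotpE /GRing.scale /=; ring.
pose phiL := GRing.isLinear.Build _ _ _ _ phi phi_lin.
pose Phi : {linear _ -> _} := HB.pack phi phiL.
have phiE p : phi (hlift p) = hcosh y p - hcosh x p.
  by rewrite /phi /= -(scaleN1r x) !dotpE; ring.
have /subvP/(_ _ xs) : (<<map hlift s>> <= lker (linfun Phi))%VS.
  apply/span_subvP => _ /mapP[p ps ->]; rewrite memv_ker lfunE /=.
  by rewrite phiE yx// subrr.
by rewrite memv_ker lfunE /= phiE subr_eq0 => /eqP.
Qed.

End hyperbolic_space.

Theorem theorem3p4 (R : realType) (n : nat) (n_gt0 : (0 < n)%N) :
  absolutely_homogeneous (hyperbolic R n).
Proof.
apply: absolutely_homogeneous_of_reflections => [|A].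
  exact: hyperbolic_has_reflections.
have [s [sA sspan]] := @finite_spanning_seq _ _ _ (@hlift R n) A.
exists s; split=> // x y /sspan xs yx.
by apply: (hcosh_span xs) => p /yx /hdist_inj.
Qed.
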